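(* Let $\kappa$ be a regular uncountable cardinal. Then the following are equivalent: (1) $\mathrm{unbounded}^+(J^{\mathrm{bd}}[\kappa],\kappa)$ holds; (2) $\mathrm{unbounded}^+(\mathcal J^\kappa_\kappa,\kappa)$ holds; (3) $\kappa$ admits a nontrivial $C$-sequence.
   Context: An ideal over $\kappa$ is a nonempty family $J$ of subsets of $\kappa$ closed under subsets and finite unions; it is $\nu$-complete if it is closed under unions of fewer than $\nu$ of its members; $J^+:=\mathcal P(\kappa)\setminus J$. $J^{\mathrm{bd}}[\kappa]$ is the ideal of bounded subsets of $\kappa$. $\mathcal J^\kappa_\kappa$ is the collection of all $\kappa$-complete ideals over $\kappa$ extending $J^{\mathrm{bd}}[\kappa]$. $[\kappa]^2$ is identified with the set of pairs $(\alpha,\beta)$ with $\alpha<\beta<\kappa$. A colouring $c:[\kappa]^2\to\theta$ is upper-regressive if $c(\alpha,\beta)<\beta$ for all $\alpha<\beta<\kappa$. For an ideal $J$ over $\kappa$ and a cardinal $\theta\le\kappa$, an upper-regressive colouring $c:[\kappa]^2\to\theta$ witnesses $\mathrm{unbounded}^+(J,\theta)$ if for every $B\in J^+$ there is $\eta<\kappa$ such that $\mathrm{otp}(\{\tau<\theta\mid\{\beta\in B\setminus(\eta+1)\mid c(\eta,\beta)=\tau\}\in J^+\})=\theta$. The principle holds if there is a witness. For a collection $\mathcal J$ of ideals over $\kappa$, $\mathrm{unbounded}^+(\mathcal J,\theta)$ holds if there is a single colouring $c$ that witnesses $\mathrm{unbounded}^+(J,\theta)$ for all $J\in\mathcal J$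 simultaneously. A $C$-sequence on $\kappa$ is a sequence $\langle C_\alpha\mid\alpha<\kappa\rangle$ such that $C_0=\emptyset$, $C_{\alpha+1}=\{\alpha\}$, and $C_\alpha$ is a closed unbounded subset of $\alpha$ for every limit ordinal $\alpha<\kappa$. It is trivial if there is a closed unbounded $C\subseteq\kappa$ such that for every $\alpha<\kappa$ there is $\beta\ge\alpha$ (with $\beta<\kappa$) such that $C\cap\alpha\subseteq C_\beta$; otherwise it is nontrivial. *)

(* Defs.v *)
From mathcomp Require Import all_boot all_order.
From mathcomp Require Import boolp classical_sets functions cardinality.

Set Implicit Arguments.
Unset Strict Implicit.
Unset Printing Implicit Defensive.

Import Order.TTheory.
Local Open Scope order_scope.
Local Open Scope classical_set_scope.
Local Open Scope card_scope.

(* The cardinal kappa is a type K, totally ordered by an orderType structure,  *)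
(* whose elements are the ordinals below kappa. An ordinal theta <= kappa is   *)
(* an initial segment of K; in particular kappa itself is [set: K], and the    *)
(* ordinal a < kappa is [segment a].                                           *)

Definition card_lt T U (A : set T) (B : set U) : Prop :=
  A #<= B /\ ~ (B #<= A).

Section Ordinals.
Context {d : Order.disp_t} {K : orderType d}.
Implicit Types (a b : K) (A B C theta : set K).

Definition segment a : set K := [set x | x < a].

Definition is_zero a : Prop := forall x, a <= x.

Definition is_succ a b : Prop := a < b /\ forall x, a < x -> b <= x.

Definition is_limit a : Prop := ~ is_zero a /\ forall x, ~ is_succ x a.

Definition cofinal_in theta A : Prop :=
  forall x, theta x -> exists y, [/\ theta y, A y & x <= y].

(* Used only for limit theta, where <= and < are interchangeable in cofinal_in. *)
Definition club_in theta C : Prop :=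
  [/\ C `<=` theta, cofinal_in theta C &
      forall a, theta a -> is_limit a -> cofinal_in (segment a) C -> C a].

(* otp(A) = theta *)
Definition otp_eq A theta : Prop :=
  exists f : K -> K, set_bij theta A f /\
    forall x y, theta x -> theta y -> x < y -> f x < f y.

End Ordinals.

(* K is an initial ordinal: it is well-ordered and every smaller ordinal has   *)
(* smaller cardinality.                                                        *)
Definition is_cardinal (d : Order.disp_t) (K : orderType d) : Prop :=
  well_founded (fun x y : K => x < y) /\
  forall a : K, card_lt (segment a) [set: K].

Definition regular_cardinal (d : Order.disp_t) (K : orderType d) : Prop :=
  [/\ is_cardinal K, infinite_set [set: K] &
      forall A : set K, cofinal_in [set: K] A -> A #= [set: K]].

Section Ideals.
Context {d : Order.disp_t} {K : orderType d}.
Implicit Types (J : set (set K)) (A B nu : set K).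

(* improper ideals are allowed *)
Definition is_ideal J : Prop :=
  [/\ J !=set0,
      forall A B, A `<=` B -> J B -> J A &
      forall A B, J A -> J B -> J (A `|` B)].

Definition positive J : set (set K) := ~` J.

(* only the cardinality of nu matters *)
Definition complete nu J : Prop :=
  forall F : set (set K), F `<=` J -> card_lt F nu -> J (\bigcup_(X in F) X).

Definition Jbd : set (set K) := [set A | exists a, A `<=` segment a].

Definition complete_ideals nu : set (set (set K)) :=
  [set J | [/\ is_ideal J, complete nu J & Jbd `<=` J]].

End Ideals.

Arguments Jbd {d} K.

Section Unbounded.
Context {d : Order.disp_t} {K : orderType d}.
Implicit Types (theta : set K) (J : set (set K)) (c : K -> K -> K).

(* A colouring of [kappa]^2 is a binary function of which only the values      *)
(* c a b with a < b are relevant.                                              *)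
Definition colouring theta c : Prop := forall a b, a < b -> theta (c a b).

Definition upper_regressive c : Prop := forall a b, a < b -> c a b < b.

Definition witnesses_unbounded_plus J theta c : Prop :=
  [/\ colouring theta c, upper_regressive c &
      forall B, positive J B -> exists eta : K,
        otp_eq [set tau | theta tau /\
                 positive J [set b | [/\ B b, eta < b & c eta b = tau]]]
               theta].

Definition unbounded_plus J theta : Prop :=
  exists c, witnesses_unbounded_plus J theta c.

Definition unbounded_plus_family (JJ : set (set (set K))) theta : Prop :=
  exists c, forall J, JJ J -> witnesses_unbounded_plus J theta c.

End Unbounded.

Section CSequences.
Context {d : Order.disp_t} {K : orderType d}.
Implicit Types (C : K -> set K).

Definition C_sequence C : Prop :=
  [/\ forall a, is_zero a -> C a = set0,
      forall a b, is_succ a b -> C b = [set a] &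
      forall a, is_limit a -> club_in (segment a) (C a)].

Definition trivial_C_sequence C : Prop :=
  exists D : set K, club_in [set: K] D /\
    forall a, exists b, a <= b /\ D `&` segment a `<=` C b.

Definition nontrivial_C_sequence C : Prop :=
  C_sequence C /\ ~ trivial_C_sequence C.

End CSequences.

(* Main.v *)
(* (2) => (1): the bounded ideal belongs to the family, by regularity.

   (1) => (3): given an upper-regressive c, let C_b consist of the points of b
   closed under c(., b) when these are cofinal in b; otherwise b is singular or
   of cofinality omega, and C_b can be taken either of order type at most
   min C_b, or without limit points. If D trivializes C, then D `&` segment a is
   too long for the last two kinds, so it is contained in C_b for some b = b(a)
   of the first kind. On the set of these b, every c(e, .) is eventually bounded
   by any point of D above e.

   (3) => (2): let c(code e n, b) be the point reached after n.+1 steps by the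
   walk from b to e along C. If c fails for J and B, there are bounds t e such
   that no point tau >= t e is visited at a given step by the walks to e from
   J-positively many b in B. Let g e b be the last point >= t e on the walk from
   b to e. Modulo J, g e b is unbounded in b, and it is nonincreasing in e because
   walks to different targets agree as long as they stay above both. By
   well-foundedness and completeness, some a0 is such that for every a there are
   positively many b with g e b = g a0 b for all e in [a0, a). As C_(g e b) meets
   [e, t e), the closure points of t above a0 below a all belong to C_(g a0 b), so
   C is trivial. *)

Require Import Defs.
From mathcomp Require Import all_boot all_order.
From mathcomp Require Import boolp classical_sets functions cardinality.

Set Implicit Arguments.
Unset Strict Implicit.
Unset Printing Implicit Defensive.

Import Order.TTheory.
Local Open Scope order_scope.
Local Open Scope classical_set_scope.
Local Open Scope card_scope.

Section RegularCardinal.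
Context {d : Order.disp_t} {K : orderType d}.
Context (reg : regular_cardinal K) (unc : ~ countable [set: K]).

(** * Minima, bounds and closure points in a regular uncountable cardinal *)

Lemma lt_wf : well_founded (fun x y : K => x < y).
Proof. by case: reg => -[]. Qed.

Lemma ex_least (A : set K) : A !=set0 ->
  exists x, A x /\ forall y, A y -> x <= y.
Proof.
move=> [x Ax]; apply: contrapT => noleast.
elim: (lt_wf x) Ax => {}x _ IH Ax; apply: noleast.
exists x; split=> // y Ay; rewrite leNgt; apply/negP => yx.
exact: IH yx Ay.
Qed.

(* [b] is a junk value, returned only when [A] is empty. *)
Definition least (b : K) (A : set K) : K :=
  xget b [set x | A x /\ forall y, A y -> x <= y].

Lemma leastP b A : A !=set0 -> A (least b A) /\ forall y, A y -> least b A <= y.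
Proof. by move=> A0; exact: (xgetPex b (ex_least A0)). Qed.

Lemma least_set0 b A : ~ (A !=set0) -> least b A = b.
Proof. by move=> A0; apply: xgetPN => x [Ax _]; apply: A0; exists x. Qed.

Lemma no_descending_seq (f : nat -> K) : ~ (forall n, f n.+1 < f n).
Proof.
move=> fd; have [|x [[n _ <-] xmin]] := @ex_least (range f).
  by exists (f 0%N); exact: imageT.
by have := xmin _ (imageT f n.+1); rewrite leNgt fd.
Qed.

Lemma card_lt_image T U (f : T -> U) (I : set T) :
  card_lt I [set: K] -> card_lt (f @` I) [set: K].
Proof.
move=> [le nge]; split; first exact: card_le_trans (card_image_le _ _) le.
by move=> ge; apply: nge; exact: card_le_trans ge (card_image_le _ _).
Qed.

Lemma card_lt_segment (a : K) : card_lt (segment a) [set: K].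
Proof. by case: reg => -[]. Qed.

Lemma card_lt_nat : card_lt [set: nat] [set: K].
Proof. by split; [apply/infiniteP; case: reg | exact: unc]. Qed.

Lemma no_max (x : K) : exists y, x < y.
Proof.
apply: contrapT => nomax; case: reg => _ + /(_ [set x]) cof; apply.
suff /cof : cofinal_in [set: K] [set x].
  rewrite card_eq_sym => /card_eqPle[le _].
  exact: card_le_finite le (finite_set1 x).
move=> y _; exists x; split=> //; rewrite leNgt; apply/negP => xy.
by apply: nomax; exists y.
Qed.

(** Regularity in usable form: a cofinal image would have full cardinality. *)
Lemma bounded_family T (I : set T) (f : T -> K) : card_lt I [set: K] ->
  exists b, forall i, I i -> f i < b.
Proof.
move=> /(card_lt_image f)[_ nge]; apply: contrapT => nob; apply: nge.
case: reg => _ _ /(_ (f @` I)) cof.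
suff /cof : cofinal_in [set: K] (f @` I) by rewrite card_eq_sym => /card_eqPle[].
move=> x _; apply: contrapT => nox; apply: nob; exists x => i Ii.
by rewrite ltNge; apply/negP => xi; apply: nox; exists (f i); split=> //; exists i.
Qed.

Lemma bounded_segment (f : K -> K) a : exists b, forall x, x < a -> f x < b.
Proof. exact: bounded_family (card_lt_segment a). Qed.

Lemma seq_sup (f : nat -> K) :
  exists s, (forall n, f n <= s) /\ forall x, x < s -> exists n, x < f n.
Proof.
have [b fb] := bounded_family f card_lt_nat.
have [|s [fs smin]] := @ex_least [set s | forall n, f n <= s].
  by exists b => n; apply/ltW/fb.
exists s; split=> // x xs; apply: contrapT => nox.
suff : s <= x by rewrite leNgt xs.
by apply: smin => n; rewrite leNgt; apply/negP => xn; apply: nox; exists n.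
Qed.

(** The supremum of the iterates of [h] at [x] works, where [h z] exceeds [z] and every [f y] with
    [y < z]; it exists because the cofinality is uncountable. *)
Lemma closure_points_cofinal (f : K -> K) x :
  exists2 s, x < s & forall y, y < s -> f y < s.
Proof.
have /choice[h hP] z : exists b, z < b /\ forall y, y < z -> f y < b.
  have [b fb] := bounded_segment f z; have [c zc] := no_max z.
  exists (Order.max b c); split; first by rewrite lt_max zc orbT.
  by move=> y yz; rewrite lt_max fb.
have [s [hs sh]] := seq_sup (fun n => iter n h x).
exists s => [|y /sh[n yn]].
  exact: lt_le_trans (hP x).1 (hs 1%N).
exact: lt_le_trans ((hP _).2 _ yn) (hs n.+1).
Qed.

Lemma unbounded_lt (A : set K) x :
  cofinal_in [set: K] A -> exists2 y, A y & x < y.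
Proof.
move=> cof; have [z xz] := no_max x; have [//|y [_ Ay zy]] := cof z.
by exists y => //; exact: lt_le_trans zy.
Qed.

(** * Increasing enumerations of unbounded sets *)

Lemma strictly_increasing_ge (P : set K) (f : K -> K) :
  (forall x y, x < y -> P y -> P x) ->
  (forall x y, P x -> P y -> x < y -> f x < f y) -> forall x, P x -> x <= f x.
Proof.
move=> Pdown incr x; elim: (lt_wf x) => {}x _ IH Px.
rewrite leNgt; apply/negP => fx.
have Pfx := Pdown _ _ fx Px; have := IH _ fx Pfx.
by rewrite leNgt incr.
Qed.

(** [f x] is the least member of [A] above all earlier values. A missed [a] in [A] would bound every
    [f x], against [a <= f a]. *)
Lemma enumeration (A : set K) : cofinal_in [set: K] A -> otp_eq A [set: K].
Proof.
move=> cof.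
pose F (x : K) (rec : forall y, y < x -> K) : K :=
  least x [set y | A y /\ forall z (zx : z < x), rec z zx < y].
pose f := Fix lt_wf (fun _ => K) F.
have fE x : f x = least x [set y | A y /\ forall z, z < x -> f z < y].
  rewrite /f Fix_eq // => {}x g1 g2 g12; rewrite /F; congr least.
  by apply/seteqP; split=> y [Ay gy]; split=> // z zx; move: (gy z zx); rewrite g12.
have fP x : [/\ A (f x), forall z, z < x -> f z < f x &
    forall y, A y -> (forall z, z < x -> f z < y) -> f x <= y].
  rewrite (fE x).
  have [|[Al lt] lmin] := @leastP x [set y | A y /\ forall z, z < x -> f z < y].
    have [b fb] := bounded_segment f x.
    have [//|y [_ Ay by_]] := cof b; exists y; split=> // z zx.
    exact: lt_le_trans (fb _ zx) by_.
  by split=> // y Ay yz; apply: lmin.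
have incr x y : x < y -> f x < f y by have [_ + _] := fP y; apply.
exists f; split=> [|x y _ _]; last exact: incr.
split=> [x _|x y _ _ fxy|a Aa]; first by have [] := fP x.
- by case: (ltgtP x y) => // /incr; rewrite fxy ltxx.
- apply: contrapT => nox.
  have lta x : f x < a.
    elim: (lt_wf x) => {}x _ IH; rewrite lt_neqAle; apply/andP; split.
      by apply/eqP => fxa; apply: nox; exists x.
    by have [_ _] := fP x; apply.
  have : a <= f a by apply: (@strictly_increasing_ge setT) => // x y _ _ /incr.
  by rewrite leNgt lta.
Qed.

Lemma otp_eq_unbounded (A : set K) x : otp_eq A [set: K] -> exists2 y, A y & x <= y.
Proof.
move=> [f [[fA _ _] incr]]; exists (f x); first exact: fA.
exact: (@strictly_increasing_ge setT).
Qed.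

(** * Limit ordinals and coding of pairs *)

Lemma is_limitP (a : K) :
  is_limit a <-> (exists x, x < a) /\ forall x, x < a -> exists2 y, x < y & y < a.
Proof.
split=> [[nz ns]|[[x xa] dense]].
  split=> [|x xa].
    apply: contrapT => nx; apply: nz => x; rewrite leNgt; apply/negP => xa.
    by apply: nx; exists x.
  apply: contrapT => ny; apply: (ns x); split=> // y xy.
  by rewrite leNgt; apply/negP => ya; apply: ny; exists y.
split=> [/(_ x)|y [ya ymin]]; first by rewrite leNgt xa.
by have [z yz za] := dense y ya; have := ymin z yz; rewrite leNgt za.
Qed.

Lemma ordinal_cases (b : K) :
  [\/ is_zero b, exists a, is_succ a b | is_limit b].
Proof.
have [z|nz] := pselect (is_zero b); first by constructor 1.
have [s|ns] := pselect (exists a, is_succ a b); first by constructor 2.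
by constructor 3; split=> // a sa; apply: ns; exists a.
Qed.

(* Writing every ordinal as [l + n] with [l] not a successor and [n] finite, and
   [l] as the [x]-th non-successor, gives the injection. *)
Lemma pairing_nat : exists code : K -> nat -> K,
  forall x n y m, code x n = code y m -> x = y /\ n = m.
Proof.
have /choice[s sP] (x : K) : exists y, is_succ x y.
  have [y yP] := @ex_least [set y | x < y] (no_max x).
  by exists y; case: yP.
have s_inj : injective s.
  move=> x y sxy; case: (ltgtP x y) => // xy.
    by have := (sP x).2 _ xy; rewrite sxy leNgt (sP y).1.
  by have := (sP y).2 _ xy; rewrite -sxy leNgt (sP x).1.
have [|E [[EL Einj _] _]] := @enumeration [set l | forall x, s x != l].
  (* A closure point of [s] is not a successor, so the non-successors are unbounded. *)
  move=> x _; have [y xy sy] := closure_points_cofinal s x.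
  exists y; split=> //; last exact: ltW.
  move=> z; apply/eqP => szy; have := sy z.
  by rewrite szy ltxx -szy (sP z).1 => /(_ isT).
exists (fun x n => iter n s (E x)) => x n y.
elim: n => [|n IH] [|m] //=.
- by move=> /Einj; rewrite !inE => ->.
- by move=> e; have /(_ (iter m s (E y))) := EL x I; rewrite -e eqxx.
- by move=> e; have /(_ (iter n s (E x))) := EL y I; rewrite e eqxx.
- by move=> /s_inj /IH[-> ->].
Qed.

(** * The bounded ideal *)

Lemma cardinal_nonempty : [set: K] !=set0.
Proof. by case: reg => _ /infinite_setN0. Qed.

Lemma positive_Jbd (B : set K) : positive (Jbd K) B <-> cofinal_in [set: K] B.
Proof.
split=> [pos x _|cof [a Ba]]; last first.
  have [//|y [_ /Ba ya]] := cof a; by rewrite leNgt ya.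
apply: contrapT => noy; apply: pos; exists x => y By.
by rewrite /segment/= ltNge; apply/negP => xy; apply: noy; exists y.
Qed.

Lemma Jbd_complete_ideal : complete_ideals [set: K] (Jbd K).
Proof.
split=> //.
- split.
  + by have [x _] := cardinal_nonempty; exists set0; exists x.
  + by move=> A B AB [a Ba]; exists a; exact: subset_trans Ba.
  + move=> A B [a Aa] [b Bb]; exists (Order.max a b); rewrite /segment in Aa Bb *.
    by move=> x [/Aa|/Bb] /= xa; rewrite lt_max xa ?orbT.
- move=> F FJ Fsmall.
  have /choice[g gP] (X : set K) : exists a, F X -> X `<=` segment a.
    have [/FJ[a Xa]|] := pselect (F X); first by exists a.
    by have [x _] := cardinal_nonempty; exists x.
  have [b gb] := bounded_family g Fsmall.
  by exists b => x [X FX /(gP _ FX) xg]; exact: lt_trans xg (gb _ FX).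
Qed.

(** * Clubs adapted to a regressive colouring *)

(** Says that the order type of [X] is at most [min X], with [e] embedding [X] into some
    [g <= min X]. *)
Definition order_embeds_below_min (X : set K) : Prop :=
  exists (e : K -> K) g, (forall x, X x -> g <= x /\ e x < g) /\
    forall x y, X x -> X y -> x < y -> e x < e y.

(** [e x] is the first index below [g] at which [f] reaches [x]. The club consists of the points
    from [g] on where [e] exceeds all its earlier values, so [e] is strictly increasing on it. *)
Lemma club_of_singular (f : K -> K) b g : is_limit b -> g < b ->
    (forall x, x < b -> exists y, y < g /\ x <= f y) ->
    (forall y, y < g -> f y < b) ->
  exists X, club_in (segment b) X /\ order_embeds_below_min X.
Proof.
move=> /is_limitP[_ blim] gb cof fb.
pose e x := least x [set y | y < g /\ x <= f y].
have eP x : x < b -> [/\ e x < g, x <= f (e x) &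
    forall y, y < g -> x <= f y -> e x <= y].
  move=> /cof /(leastP x)[[eg xf] emin]; split=> // y yg xy; exact: emin.
have emono x y : x <= y -> y < b -> e x <= e y.
  move=> xy yb; have [_ _] := eP x (le_lt_trans xy yb); have [eg yf _] := eP y yb.
  by apply=> //; exact: le_trans yf.
exists [set x | [/\ x < b, g <= x & forall y, y < x -> e y < e x]]; split; last first.
  exists e, g; split=> [x [xb gx _]|x y _ [_ _]]; last by apply.
  by split=> //; have [] := eP x xb.
split=> [x []//|z /= zb|a ab alim acof].
- pose z' := Order.max z g; have zb' : z' < b by rewrite gt_max zb.
  have [eg zf _] := eP _ zb'.
  (* [w] shows that [e] grows beyond [e z']; the first point where it does lies in the club. *)
  have [w vw wb] := blim _ (fb _ eg).
  have [|x [[xb zx] xmin]] := @ex_least [set x | x < b /\ e z' < e x].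
    exists w; split=> //; have [ewg wf ewmin] := eP w wb.
    rewrite ltNge; apply/negP => ew.
    have [_ _ /(_ _ ewg)] := eP _ zb'.
    have zw : z' <= f (e w) by apply: le_trans wf; apply: le_trans zf _; exact: ltW.
    move=> /(_ zw) ew'; have ee : e w = e z' by apply/eqP; rewrite eq_le ew.
    by move: wf; rewrite ee leNgt vw.
  have z'x : z' < x.
    by rewrite ltNge; apply/negP => /emono /(_ zb'); rewrite leNgt zx.
  move: (z'x); rewrite gt_max => /andP[zx' gx].
  exists x; split=> //; last exact: ltW.
  split=> //; first exact: ltW.
  move=> y yx; apply: le_lt_trans zx; rewrite leNgt; apply/negP => zy.
  by have := xmin y (conj (lt_trans yx xb) zy); rewrite leNgt yx.
- move/is_limitP: alim => [[a0 a0a] alim]; split=> //.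
    have [y [ya [_ gy _] _]] := acof _ a0a.
    by apply: le_trans gy _; exact: ltW.
  move=> y ya; have [y' yy' y'a] := alim y ya.
  have [x [xa [_ _ ex] y'x]] := acof _ y'a.
  by apply: lt_le_trans (ex _ (lt_le_trans yy' y'x)) _; apply: emono => //; exact: ltW.
Qed.

Definition no_limit_point_below (b : K) (X : set K) : Prop :=
  forall a, a < b -> is_limit a -> ~ cofinal_in (segment a) X.

(** Below a limit [a < b] lie only the [x k] with [k] less than the first [m] such that [a <= x m],
    and finitely many points are not cofinal in [a]. *)
Lemma club_of_omega (x : nat -> K) b : is_limit b ->
    (forall n, x n < x n.+1) -> (forall n, x n < b) ->
    (forall z, z < b -> exists n, z < x n) ->
  club_in (segment b) (range x) /\ no_limit_point_below b (range x).
Proof.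
move=> blim xincr xb xcof.
have nolim : no_limit_point_below b (range x).
  move=> a ab /is_limitP[[a0 a0a] alim] acof.
  have [n nP] := xcof _ ab.
  have [m] : exists m, a <= x m /\ forall k, (k < m)%N -> x k < a.
    have ex : exists n, a <= x n by exists n; exact: ltW.
    exists (ex_minn ex); case: ex_minnP => m am mmin; split=> // k km.
    by rewrite ltNge; apply/negP => /mmin; rewrite leqNgt km.
  have xmono : {homo x : i j / (i <= j)%N >-> i <= j}.
    by apply: (@homo_leq _ x <=%O lexx le_trans) => i; exact: ltW.
  case: m => [|m] [am mlt].
    have [y [ya [k _ xk] _]] := acof _ a0a.
    by have := le_trans am (xmono 0%N k isT); rewrite xk leNgt ya.
  have [y xy ya] := alim _ (mlt m (ltnSn m)).
  have [z [za [k _ xk] yz]] := acof _ ya.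
  have mk : (m < k)%N.
    rewrite ltnNge; apply/negP => /xmono; rewrite xk leNgt.
    by rewrite (lt_le_trans xy yz).
  by have := le_trans am (xmono _ _ mk); rewrite xk leNgt za.
split=> //; split=> [_ [n _ <-]|z /xcof[n zn]|a ab alim acof].
- exact: xb.
- by exists (x n); split; [exact: xb|exact: imageT|exact: ltW].
- by have := nolim a ab alim.
Qed.

Lemma club_adapted_to_regressive (f : K -> K) b :
    is_limit b -> (forall x, x < b -> f x < b) ->
  exists X, club_in (segment b) X /\
    [\/ forall x y, X x -> y < x -> f y < x, order_embeds_below_min X |
        no_limit_point_below b X].
Proof.
move=> blim fb; have /is_limitP[[b0 b0b] bdense] := blim.
pose X := [set x | x < b /\ forall y, y < x -> f y < x].
have [Xcof|] := pselect (cofinal_in (segment b) X).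
  exists X; split; last by constructor 1 => x y [_]; apply.
  split=> // [x []//|a ab /is_limitP[_ adense] acof]; split=> // y ya.
  have [y' yy' y'a] := adense y ya; have [z [za [_ fz] y'z]] := acof _ y'a.
  exact: lt_trans (fz _ (lt_le_trans yy' y'z)) za.
move=> /existsNP[x0 /not_implyP[x0b nX]].
have [[g [gb gcof]]|nsing] :=
    pselect (exists g, g < b /\ forall x, x < b -> exists y, y < g /\ x <= f y).
  have [|Y [Yclub Yemb]] := club_of_singular blim gb gcof.
    by move=> y yg; apply: fb; exact: lt_trans gb.
  by exists Y; split=> //; constructor 2.
(* No [g < b] is mapped cofinally into [b], so the values of [f] below any [z < b] are bounded in
   [b] and [h] can be iterated inside [b]. *)
have /choice[h hP] z : exists u, z < b ->
    [/\ z < u, u < b & forall y, y < z -> f y < u].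
  have [zb|] := pselect (z < b); last by exists z.
  have [x /not_implyP[xb nx]] : exists x, ~ (x < b -> exists y, y < z /\ x <= f y).
    by apply/existsNP => all; apply: nsing; exists z.
  have zxb : Order.max z x < b by rewrite gt_max zb.
  have [u + ub] := bdense _ zxb; rewrite gt_max => /andP[zu xu].
  exists u => _; split=> // y yz.
  rewrite ltNge; apply/negP => uy; apply: nx; exists y; split=> //.
  by apply: le_trans uy; exact: ltW.
pose x n := iter n h x0.
have xb n : x n < b by elim: n => [//|n /hP[]].
have xincr n : x n < x n.+1 by case: (hP _ (xb n)).
exists (range x); suff xcof : forall z, z < b -> exists n, z < x n.
  by have [] := club_of_omega blim xincr xb xcof; split=> //; constructor 3.
(* A supremum [s < b] would be a closure point of [f] above [x0], against the choice of [x0]; hence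
   the iterates are cofinal in [b]. *)
have [s [xs sx]] := seq_sup x.
have [sb|bs] := ltP s b; last by move=> z zb; apply: sx; exact: lt_le_trans bs.
case: nX; exists s; split=> //; last exact: xs 0%N.
split=> // y /sx[n yn]; apply: lt_le_trans (xs n.+1).
by have [_ _] := hP _ (xb n); apply.
Qed.

Lemma adapted_C_sequence (c : K -> K -> K) :
    (forall a b, a < b -> c a b < b) ->
  exists C : K -> set K, C_sequence C /\ forall b,
    [\/ forall x y, C b x -> y < x -> c y b < x, order_embeds_below_min (C b) |
        no_limit_point_below b (C b)].
Proof.
move=> creg.
suff /choice[C CP] : forall b, exists X : set K,
    [/\ is_zero b -> X = set0, forall a, is_succ a b -> X = [set a],
        is_limit b -> club_in (segment b) X &
        [\/ forall x y, X x -> y < x -> c y b < x, order_embeds_below_min X |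
            no_limit_point_below b X]].
  exists C; split=> [|b]; last by have [] := CP b.
  by split=> [a|a b|a]; [have [+ _ _ _] := CP a|have [_ + _ _] := CP b|
                         have [_ _ + _] := CP a]; apply.
move=> b; have [bz|[a [ab bmin]]|blim] := ordinal_cases b.
- exists set0; split=> // [a [ab _]|[]//|]; first by have := bz a; rewrite leNgt ab.
  by constructor 1.
- exists [set a]; split=> [/(_ a)|a' [a'b b'min]|[_ /(_ a)[]]//|].
  + by rewrite leNgt ab.
  + congr [set _]; case: (ltgtP a a') => // [/bmin|/b'min]; rewrite leNgt.
      by rewrite a'b.
    by rewrite ab.
  + constructor 3 => x xb /is_limitP[[y yx] xdense] xcof.
    have [_ [/[swap] -> ax _]] := xcof _ yx; have [z az zx] := xdense _ ax.
    by have [_ [_ -> ]] := xcof _ zx; rewrite leNgt az.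
- have [X [Xclub XP]] :=
    @club_adapted_to_regressive (c^~ b) b blim (fun x => @creg x b).
  exists X; split=> // [/(blim.1)//|a /(blim.2)//].
Qed.

(** * From a colouring to a nontrivial C-sequence *)

Lemma cofinal_segment (D : set K) a :
  (forall x, x < a -> exists y, [/\ y < a, D y & x < y]) -> cofinal_in (segment a) D.
Proof. by move=> H x /H[y [ya Dy /ltW xy]]; exists y. Qed.

Lemma nontrivial_C_sequence_of_unbounded :
  unbounded_plus (Jbd K) [set: K] -> exists C : K -> set K, nontrivial_C_sequence C.
Proof.
move=> [c [_ creg cwit]]; have [C [Cseq CP]] := adapted_C_sequence creg.
exists C; split=> // -[D [[_ Dcof _] Dtriv]].
have [x0 _] := cardinal_nonempty.
have [//|m [_ Dm _]] := Dcof x0.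
have /choice[nx nxP] x : exists y, D y /\ x < y.
  by have [y Dy xy] := unbounded_lt x Dcof; exists y.
have [l ml nxl] := closure_points_cofinal nx m.
have llim : is_limit l.
  apply/is_limitP; split=> [|x /nxl xl]; first by exists m.
  by exists (nx x); rewrite ?(nxP x).2.
have lcof : cofinal_in (segment l) D.
  by apply: cofinal_segment => x /nxl xl; exists (nx x); case: (nxP x).
have [E [[ED _ _] Eincr]] := enumeration Dcof.
(* Below [a0], [D] accumulates at [l] and contains every [E i] with [i <= m]: too much for the other
   two kinds of [C b]. *)
have [a0 [la0 Ea0]] : exists a0, l < a0 /\ E m < a0.
  have [a0 aP] := no_max (Order.max l (E m)).
  by exists a0; move: aP; rewrite gt_max => /andP[].
have good a b : a0 <= a -> a <= b -> D `&` segment a `<=` C b ->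
    forall x y, C b x -> y < x -> c y b < x.
  move=> a0a ab DC; case: (CP b) => // [[e [g [eg eincr]]]|/(_ l)].
    have EC i : i <= m -> C b (E i).
      move=> im; apply: DC; split; first exact: ED.
      apply: lt_le_trans a0a; apply: le_lt_trans Ea0.
      by move: im; rewrite le_eqVlt => /predU1P[->|/Eincr] //; move=> /(_ I I)/ltW.
    have gm : g <= m.
      have Cm : C b m.
        by apply: DC; split=> //; exact: lt_trans ml (lt_le_trans la0 a0a).
      by have [] := eg _ Cm.
    (* The map sending [i <= m] to [e (E i)] is increasing with values below [g], yet [g <= m]
       because [m] is in [C b]. *)
    have : m <= e (E m).
      apply: (@strictly_increasing_ge [set i | i <= m] (e \o E)) => /=.
      - by move=> i j ij; apply: le_trans; exact: ltW.
      - by move=> i j /EC Ci /EC Cj ij; apply: eincr => //; exact: Eincr.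
      - exact: lexx.
    rewrite leNgt (lt_le_trans _ gm) //.
    by have [] := eg _ (EC m (lexx m)).
  case=> //; first exact: lt_le_trans la0 (le_trans a0a ab).
  move=> x /lcof[y [yl Dy xy]]; exists y; split=> //; apply: DC; split=> //.
  exact: lt_trans yl (lt_le_trans la0 a0a).
have /choice[bt btP] a : exists b, a <= b /\ D `&` segment a `<=` C b := Dtriv a.
pose B := [set b | exists2 a, a0 <= a & b = bt a].
have /positive_Jbd /cwit [eta /otp_eq_unbounded otp] : cofinal_in [set: K] B.
  move=> x _; exists (bt (Order.max a0 x)); split=> //.
    by exists (Order.max a0 x); rewrite // le_max lexx.
  by apply: le_trans (btP _).1; rewrite le_max lexx orbT.
(* Some colour [tau >= g] occurs at [eta] for unboundedly many [b] in [B]. Taking [b] beyond [bt a]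
   for all [a <= g] puts [g] in [C b], and closure of [g] under [c(., b)] forces the colour below
   [g]. *)
have [g Dg etag] := unbounded_lt eta Dcof.
have [tau [_ /positive_Jbd pos] gtau] := otp g.
have [g' gg'] := no_max g; have [u btu] := bounded_segment bt g'.
have [//|b [_ [[a a0a ->] eb cb] ub]] := pos u.
have ag : g < a.
  rewrite ltNge; apply/negP => ag.
  by move: ub; rewrite leNgt btu // (le_lt_trans ag).
have [ab DC] := btP a.
have Cg : C (bt a) g by apply: DC; split.
by have := good _ _ a0a ab DC _ _ Cg etag; rewrite cb ltNge gtau.
Qed.

(** * Walks along a C-sequence *)

Section Walks.
Context (C : K -> set K) (Cseq : C_sequence C).

(** The default [b] makes a walk stay at [e] once it has arrived there. *)
Definition step (e b : K) : K := least b [set x | C b x /\ e <= x].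

Definition walk (e b : K) (n : nat) : K := iter n (step e) b.

Lemma C_sequence_lt b x : C b x -> x < b.
Proof.
case: Cseq => C0 Csucc Clim.
have [/C0 ->//|[a sab]|/Clim[Cb _ _] /Cb //] := ordinal_cases b.
by rewrite (Csucc _ _ sab) => ->; case: sab.
Qed.

Lemma step_lt e b : e < b -> [/\ C b (step e b), e <= step e b & step e b < b].
Proof.
move=> eb; suff /(leastP b)[[Cs es] _] : [set x | C b x /\ e <= x] !=set0.
  by split=> //; exact: C_sequence_lt Cs.
case: Cseq => _ Csucc Clim.
have [bz|[a sab]|/Clim[_ Ccof _]] := ordinal_cases b.
- by have := bz e; rewrite leNgt eb.
- exists a; rewrite (Csucc _ _ sab); split=> //.
  by rewrite leNgt; apply/negP => ae; have := sab.2 _ ae; rewrite leNgt eb.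
- by have [x [_ Cx ex]] := Ccof _ eb; exists x.
Qed.

Lemma step_diag e : step e e = e.
Proof. by apply: least_set0 => -[x [/C_sequence_lt + ex]]; rewrite ltNge ex. Qed.

Lemma step_bounds e b : e <= b -> e <= step e b <= b.
Proof.
rewrite le_eqVlt => /predU1P[->|/step_lt[_ -> /ltW //]].
by rewrite step_diag lexx.
Qed.

Lemma walk_bounds e b n : e <= b -> e <= walk e b n <= b.
Proof.
move=> eb; elim: n => [|n /andP[en nb]]; first by rewrite /= eb lexx.
by have /andP[-> /le_trans -> //] := step_bounds en.
Qed.

(** If the least point of [C] from [e] on is at least [e'], it is also the least from [e'] on, so
    both walks take the same step. *)
Lemma walk_coherent e e' b n : e <= e' -> e <= b -> e' <= walk e b n ->
  walk e' b n = walk e b n.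
Proof.
move=> ee' eb; elim: n => [//|n IH] /= e'n.
have /andP[en _] := walk_bounds n eb.
rewrite IH; last by apply: le_trans e'n _; have /andP[] := step_bounds en.
congr least; apply/seteqP; split=> x [Cx ex]; split=> //; first exact: le_trans ex.
have [|_ /(_ x (conj Cx ex)) lex] :=
  @leastP (walk e b n) [set x | C (walk e b n) x /\ e <= x].
  by exists x.
exact: le_trans e'n lex.
Qed.

(** * Complete ideals, and triviality from bounded fibres *)

Context (J : set (set K)) (Jci : complete_ideals [set: K] J).

Lemma ideal_sub A B : A `<=` B -> J B -> J A.
Proof. by case: Jci => -[_ + _] _ _; apply. Qed.

Lemma ideal_setU A B : J A -> J B -> J (A `|` B).
Proof. by case: Jci => -[_ _ +] _ _; apply. Qed.

Lemma ideal_le a : J [set b | b <= a].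
Proof.
case: Jci => _ _; apply; have [a' aa'] := no_max a.
by exists a' => b ba; exact: le_lt_trans aa'.
Qed.

Lemma ideal_bigcup T (I : set T) (F : T -> set K) : card_lt I [set: K] ->
  (forall i, I i -> J (F i)) -> J [set b | exists2 i, I i & F i b].
Proof.
case: Jci => _ Jc _ Ismall JF.
apply: ideal_sub (Jc (F @` I) _ (card_lt_image F Ismall)).
  by move=> b [i Ii Fb]; exists (F i) => //; exists i.
by move=> _ [i Ii <-]; exact: JF.
Qed.

Lemma trivial_of_bounded_fibres (B : set K) : positive J B ->
    (forall e n, exists t, forall tau, t <= tau ->
      J [set b | [/\ B b, e < b & walk e b n.+1 = tau]]) ->
  trivial_C_sequence C.
Proof.
move=> JB fib.
(* One bound serves all [n], by uncountable cofinality; for [n = 0] the fibre has at most one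
   point. *)
have /choice[t tP] e : exists t, e < t /\ forall n tau, t <= tau ->
    J [set b | [/\ B b, e < b & walk e b n = tau]].
  have /choice[t' t'P] := fib e.
  have [t t't] := bounded_family t' card_lt_nat; have [e' ee'] := no_max e.
  exists (Order.max t e'); split; first by rewrite lt_max ee' orbT.
  move=> [|n] tau; rewrite ge_max => /andP[ttau _].
    by apply: ideal_sub (ideal_le tau) => b [_ _ /= ->].
  by apply: t'P; apply: le_trans ttau; apply/ltW/t't.
have Jfib e u : J [set b | [/\ B b, e < b & exists n, t e <= walk e b n <= u]].
  have [u' uu'] := no_max u.
  apply: ideal_sub (@ideal_bigcup _ (segment u')
    (fun tau => [set b | exists2 n, [set: nat] n &
      [/\ B b, e < b, walk e b n = tau & t e <= tau]]) (card_lt_segment u') _).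
    move=> b [Bb eb [n /andP[tn nu]]]; exists (walk e b n).
      exact: le_lt_trans uu'.
    by exists n.
  move=> tau _; apply: (ideal_bigcup card_lt_nat) => n _.
  have [ttau|_] := leP (t e) tau.
    by apply: ideal_sub ((tP e).2 n tau ttau) => b [].
  by apply: ideal_sub (ideal_le e) => b [].
(* The walk descends, so this least value is its last point not below [t e]; the next step then
   lands in [[e, t e)]. *)
pose g e b := least b [set x | t e <= x /\ exists n, x = walk e b n].
have gP e b : t e <= b -> [/\ t e <= g e b, exists n, g e b = walk e b n,
    forall n, t e <= walk e b n -> g e b <= walk e b n &
    exists x, [/\ C (g e b) x, e <= x & x < t e]].
  move=> tb.
  have [|[tg [n gn]] gmin] := @leastP b [set x | t e <= x /\ exists n, x = walk e b n].
    by exists b; split=> //; exists 0%N.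
  rewrite -/(g e b) in tg gn gmin; split=> //; first by exists n.
    by move=> k tk; apply: gmin; split=> //; exists k.
  have [Cx ex xg] := step_lt (lt_le_trans (tP e).1 tg).
  exists (step e (g e b)); split=> //; rewrite ltNge; apply/negP => tx.
  have : g e b <= step e (g e b) by apply: gmin; split=> //; exists n.+1; rewrite gn.
  by rewrite leNgt xg.
have Jg e u : J [set b | B b /\ g e b <= u].
  apply: ideal_sub (ideal_setU (ideal_le (t e)) (Jfib e u)) => b [Bb gu].
  have [bt|tb] := leP b (t e); [by left|right].
  have [tg [n gn] _ _] := gP e b (ltW tb).
  by split=> //; [exact: lt_trans (tP e).1 tb|exists n; rewrite -gn tg].
have g_nonincr e e' b : e <= e' -> t e <= b -> t e' <= b -> t e' <= g e b ->
    g e' b <= g e b.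
  move=> ee' tb t'b t'g; have [_ [n gn] _ _] := gP e b tb.
  have [_ _ g'min _] := gP e' b t'b.
  have wE : walk e' b n = walk e b n.
    apply: walk_coherent => //; first exact: le_trans (ltW (tP e).1) tb.
    by rewrite -gn; apply: le_trans t'g; exact/ltW/(tP e').1.
  by have := g'min n; rewrite wE -gn; apply.
have /choice[S SP] a : exists s, forall e, e < a -> t e < s := bounded_segment t a.
(* Off this small set, [b] and every [g e b] with [e < a] lie above all [t e'] with [e' < a], which
   is what [g_nonincr] requires. *)
pose exc a := [set b | B b /\ (b <= S a \/ exists2 e, e < a & g e b <= S a)].
have Jexc a : J (exc a).
  apply: ideal_sub (ideal_setU (ideal_le (S a)) (@ideal_bigcup _ (segment a)
    (fun e => [set b | B b /\ g e b <= S a]) (card_lt_segment a) _)) => //.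
  by move=> b [Bb [bS|[e ea gS]]]; [left|right; exists e].
have t_le a b e : B b -> ~ exc a b -> e < a -> t e <= b.
  move=> Bb nexc ea; rewrite leNgt; apply/negP => bt; apply: nexc.
  by split=> //; left; apply: ltW; exact: lt_trans (SP a e ea).
have g_le a b e e' : B b -> ~ exc a b -> e <= e' -> e' < a -> g e' b <= g e b.
  move=> Bb nexc ee' e'a; have ea := le_lt_trans ee' e'a.
  apply: g_nonincr => //; [exact: t_le nexc ea|exact: t_le nexc e'a|].
  rewrite leNgt; apply/negP => gt; apply: nexc; split=> //; right; exists e => //.
  by apply: ltW; exact: lt_trans gt (SP _ _ e'a).
(* Otherwise almost every [b] would yield an infinite descent of the values [g e b]. *)
have [a0 stab] : exists a0, forall a, a0 < a ->
    ~ J [set b | B b /\ forall e, a0 <= e -> e < a -> g e b = g a0 b].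
  apply: contrapT => nstab.
  have /choice[nx nxP] a0 : exists a, a0 < a /\
      J [set b | B b /\ forall e, a0 <= e -> e < a -> g e b = g a0 b].
    apply: contrapT => na; apply: nstab; exists a0 => a aa0 Ja.
    by apply: na; exists a.
  have [x0 _] := cardinal_nonempty; pose al n := iter n nx x0.
  have [a ala] := bounded_family al card_lt_nat.
  apply: JB; apply: ideal_sub (ideal_setU (Jexc a)
    (ideal_bigcup card_lt_nat (fun n _ => (nxP (al n)).2))) => b Bb.
  have [|nexc] := pselect (exc a b); [by left|right].
  apply: contrapT => nb; apply: (@no_descending_seq (fun n => g (al n) b)) => n.
  have [e [ne en gne]] : exists e, [/\ al n <= e, e < al n.+1 & g e b != g (al n) b].
    apply: contrapT => ne; apply: nb; exists n => //; split=> // e ale ean.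
    by apply/eqP/negPn/negP => gne; apply: ne; exists e.
  have ea : e < a by exact: lt_trans (ala n.+1 I).
  apply: (@le_lt_trans _ _ (g e b)); first exact: g_le nexc (ltW en) (ala _ I).
  by rewrite lt_neqAle gne (g_le a).
exists [set x | a0 < x /\ forall e, e < x -> t e < x]; split; last first.
  move=> a; have [a'] := no_max (Order.max a0 a); rewrite gt_max => /andP[a0a' aa'].
  (* A positive set is not covered by two members of the ideal, so some [b] is stable up to [a'],
     not exceptional, and has [g a0 b] above [a]. *)
  have [b [[Bb bstab] nb]] : exists b,
      (B b /\ forall e, a0 <= e -> e < a' -> g e b = g a0 b) /\
      ~ (exc a' b \/ (B b /\ g a0 b <= a)).
    apply: contrapT => nb; apply: (stab a' a0a').
    apply: ideal_sub (ideal_setU (Jexc a') (Jg a0 a)) => b bP.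
    by apply: contrapT => bn; apply: nb; exists b.
  have nexc : ~ exc a' b by move=> ?; apply: nb; left.
  have ag : a < g a0 b.
    by rewrite ltNge; apply/negP => ga; apply: nb; right.
  exists (g a0 b); split; first exact: ltW.
  move=> x [[a0x xcl] xa].
  (* The step from [g e b = g a0 b] towards [e] lands below [t e], and [t e < x] as [x] is a closure
     point; so [x] is a limit of [C (g a0 b)]. *)
  have near e : a0 <= e -> e < x -> exists y, [/\ C (g a0 b) y, e <= y & y < x].
    move=> a0e ex; have ea' : e < a' by exact: lt_trans ex (lt_trans xa aa').
    have [_ _ _ [y [Cy ey yt]]] := gP e b (t_le _ _ _ Bb nexc ea').
    exists y; rewrite -(bstab e) //; split=> //; exact: lt_trans (xcl _ ex).
  have xg : x < g a0 b by exact: lt_trans ag.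
  case: Cseq => _ Csucc Clim.
  have [gz|[p sp]|/Clim[_ _ Cclosed]] := ordinal_cases (g a0 b).
  - by have := gz x; rewrite leNgt xg.
  - have [y [+ _ yx]] := near a0 (lexx _) a0x; rewrite (Csucc _ _ sp) /= => yp.
    by have := sp.2 x; rewrite leNgt xg -yp => /(_ yx).
  - apply: Cclosed => //.
      apply/is_limitP; split=> [|y yx]; first by exists a0.
      by exists (t y); [exact: (tP y).1|exact: xcl].
    move=> y yx; have [||z [Cz yz zx]] := near (Order.max a0 y).
    + by rewrite le_max lexx.
    + by rewrite gt_max a0x.
    by exists z; split=> //; move: yz; rewrite ge_max => /andP[].
split=> // [x _|a _ /is_limitP[[z za] alim] acof].
- have [s xs scl] := closure_points_cofinal t (Order.max a0 x).
  move: xs; rewrite gt_max => /andP[a0s xs].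
  by exists s; split=> //; exact: ltW.
- split=> [|e ea]; first by have [y [ya [a0y _] _]] := acof _ za; exact: lt_trans ya.
  have [e' ee' e'a] := alim _ ea; have [y [ya [_ ycl] e'y]] := acof _ e'a.
  exact: lt_trans (ycl _ (lt_le_trans ee' e'y)) ya.
Qed.

End Walks.

(** * From a nontrivial C-sequence to a colouring *)

Lemma unbounded_family_of_nontrivial (C : K -> set K) : nontrivial_C_sequence C ->
  unbounded_plus_family (complete_ideals [set: K]) [set: K].
Proof.
move=> [Cseq Cntriv]; have [code code_inj] := pairing_nat.
(* At least one step is taken, so the value drops below [q.2]; if [q.1] codes no pair with
   [e < q.2], the value is [q.1] itself. *)
have /choice[c cP] (q : K * K) : exists v, (q.1 < q.2 -> v < q.2) /\
    forall e n, code e n = q.1 -> e < q.2 -> v = walk C e q.2 n.+1.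
  case: q => a b /=.
  have [[e [n [ea eb]]]|ne] := pselect (exists e n, code e n = a /\ e < b).
    exists (walk C e b n.+1); split=> [_|e' n']; last first.
      by rewrite -ea => /code_inj[-> ->].
    rewrite /walk iterSr; have [_ es sb] := step_lt Cseq eb.
    by have /andP[_ /le_lt_trans] := walk_bounds Cseq n es; apply.
  by exists a; split=> // e n ea eb; case: ne; exists e, n.
exists (fun a b => c (a, b)) => J Jci; split=> // [a b ab|B JB].
  exact: (cP (a, b)).1.
apply: contrapT => notp; apply: Cntriv.
apply: (trivial_of_bounded_fibres Cseq Jci JB) => e n; set a := code e n.
(* An unbounded set of positive colours would have full order type, so failure at [a] bounds them by
   some [t]. *)
have ncof : ~ cofinal_in [set: K] [set tau | setT tau /\
    positive J [set b | [/\ B b, a < b & c (a, b) = tau]]].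
  by move=> /enumeration otp; apply: notp; exists a.
move/existsNP: ncof => [t /not_implyP[_ tmax]]; exists t => tau ttau.
have Jtau : J [set b | [/\ B b, a < b & c (a, b) = tau]].
  by apply: contrapT => pos; apply: tmax; exists tau.
apply: (ideal_sub Jci _ (ideal_setU Jci (ideal_le Jci a) Jtau)) => b [Bb eb wtau].
have [ba|ab] := leP b a; [by left|right].
by split=> //; rewrite -wtau; apply: (cP (a, b)).2.
Qed.

End RegularCardinal.

Local Open Scope classical_set_scope.

Theorem theorem1 (d : Order.disp_t) (K : orderType d)
    (reg : regular_cardinal K) (unc : ~ countable [set: K]) :
  (unbounded_plus (Jbd K) [set: K] <->
   unbounded_plus_family (complete_ideals [set: K]) [set: K]) /\
  (unbounded_plus_family (complete_ideals [set: K]) [set: K] <->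
   exists C : K -> set K, nontrivial_C_sequence C).
Proof.
have fam_Jbd : unbounded_plus_family (complete_ideals [set: K]) [set: K] ->
    unbounded_plus (Jbd K) [set: K].
  by move=> [c cP]; exists c; apply: cP; exact: Jbd_complete_ideal.
have Jbd_C := nontrivial_C_sequence_of_unbounded reg unc.
have C_fam (C : K -> set K) := @unbounded_family_of_nontrivial _ _ reg unc C.
split; split=> //.
- by move=> /Jbd_C[C /C_fam].
- by move=> /fam_Jbd/Jbd_C.
- by move=> [C /C_fam].
Qed.
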